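(* The number of families $\mathcal F\subseteq\mathcal P(n)$ for which there exists a partition $R\cup W=[n]$ such that $\mathcal F$ contains no pair $A,B$ that is comparable with monochromatic difference is $2^{\binom{n}{\lfloor n/2\rfloor}(1+o(1))}$, where $o(1)\to0$ as $n\to\infty$.
   Context: Given a partition (two-colouring) $R\cup W$ of $[n]$, a pair of sets $A,B\subseteq[n]$ is comparable with monochromatic difference if $A\subsetneq B$ and $B\setminus A\subseteq R$ or $B\setminus A\subseteq W$. *)

(* Defs.v *)
From mathcomp Require Import all_boot.

Set Implicit Arguments.
Unset Strict Implicit.
Unset Printing Implicit Defensive.

(* The ground set [n] is 'I_n, and P(n) is {set 'I_n}. *)

(* One of the two colour classes may be empty; they need not both occur. *)
Definition two_colouring (n : nat) (R W : {set 'I_n}) : bool :=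
  (R :|: W == [set: 'I_n]) && [disjoint R & W].

Definition comparable_mono_diff (n : nat) (R W A B : {set 'I_n}) : bool :=
  (A \proper B) && ((B :\: A \subset R) || (B :\: A \subset W)).

Definition mono_diff_free (n : nat) (R W : {set 'I_n})
    (F : {set {set 'I_n}}) : bool :=
  [forall A in F, forall B in F, ~~ comparable_mono_diff R W A B].

Definition num_families (n : nat) : nat :=
  #|[set F : {set {set 'I_n}} |
      [exists R : {set 'I_n}, exists W : {set 'I_n},
        two_colouring R W && mono_diff_free R W F]]|.

(* Main.v *)
(* Upper bound. Fix a colouring, with r = #|R| and w = #|W|. A pair of random maximal
   chains of P(R) and P(W) spans a grid in P(R) x P(W) = P(n). On a grid, a family
   without forbidden pairs has at most one element per row and per column, so when the
   cell (i, j) is given the weight C(r, i) C(w, j) its total weight is at most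
   C(n, n./2); averaging over grids then bounds the size of the family. The same
   averaging applied after deleting the upper end of each forbidden pair is robust: if
   every member of F lies above at most d others, with d a small multiple of n, then
   #|F| <= (1 + o(1)) C(n, n./2). When one colour class is much smaller than n, only
   differences inside the other class are used.
   So any larger family has a member with large in-degree, and branching on such a
   member counts the families without forbidden pairs by 2 ^ ((1 + o(1)) C(n, n./2)).
   The 2 ^ n colourings are absorbed in the error term.
   Lower bound: any subfamily of the middle layer is an antichain. *)
Require Import Defs.
From mathcomp Require Import all_boot all_order all_algebra all_fingroup.
From mathcomp Require Import zify ring.
Import Order.TTheory GRing.Theory Num.Theory.

Set Implicit Arguments.
Unset Strict Implicit.
Unset Printing Implicit Defensive.

(** * Central binomial coefficients and weighted matchings *)

Lemma bin_leqS (n k : nat) : k.*2 < n -> 'C(n, k) <= 'C(n, k.+1).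
Proof.
move=> lt_kn; have := mul_bin_left n k.
have : k.+1 <= n - k by lia.
have := bin_gt0 n k; have -> : k <= n by lia.
nia.
Qed.

Lemma bin_leq_lower (n j k : nat) : j <= k -> k.*2 <= n -> 'C(n, j) <= 'C(n, k).
Proof.
elim: k => [|k IHk]; first by rewrite leqn0 => /eqP->.
rewrite leq_eqVlt => /predU1P[-> //|le_jk le_kn].
by apply: leq_trans (IHk _ _) (bin_leqS _); lia.
Qed.

(** With truncated subtraction, [(k.*2 - n) + (n - k.*2)] is the distance |2k - n| from the centre.
    Reflecting [k] to [n - k] reduces to the lower half, where the coefficients increase. *)
Lemma leq_bin_dist (n i j : nat) : i <= n -> j <= n ->
  (j.*2 - n) + (n - j.*2) <= (i.*2 - n) + (n - i.*2) -> 'C(n, i) <= 'C(n, j).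
Proof.
have wlog_low k : k <= n ->
    exists2 k', 'C(n, k') = 'C(n, k) & (k'.*2 - n) + (n - k'.*2) = (k.*2 - n) + (n - k.*2) /\ k'.*2 <= n.
  move=> le_kn; case: (leqP k.*2 n) => [le2|lt2]; first by exists k.
  by exists (n - k); [apply: bin_sub | lia].
move=> /wlog_low[i' <- [<- lei]] /wlog_low[j' <- [<- lej]] dist.
by apply: bin_leq_lower; lia.
Qed.

Lemma bin_le_mid (n k : nat) : 'C(n, k) <= 'C(n, n./2).
Proof.
case: (leqP k n) => [le_kn|/bin_small-> //].
by apply: leq_bin_dist => //; lia.
Qed.

Lemma bin_mid_even (m : nat) : m.+1 * 'C(m.*2.+1, m) = m.*2.+1 * 'C(m.*2, m).
Proof.
have := mul_bin_diag m.*2.+1 m; rewrite -[m.*2.+1.-1]/(m.*2) => ->.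
congr (_ * _).
rewrite -(@bin_sub m.*2.+1 m); last by lia.
by congr 'C(_, _); lia.
Qed.

Lemma bin_mid_odd (m : nat) : 'C(m.+1.*2, m.+1) = 2 * 'C(m.*2.+1, m).
Proof.
rewrite doubleS binS -(@bin_sub m.*2.+1 m.+1); last by lia.
by rewrite (_ : m.*2.+1 - m.+1 = m); lia.
Qed.

(** Even [n] gives equality and odd [n] exact doubling. The factors n + 1 and n + 2 telescope when
    the bound is iterated. *)
Lemma bin_midS (n : nat) : 2 * n.+1 * 'C(n, n./2) <= n.+2 * 'C(n.+1, n.+1./2).
Proof.
have := odd_double_half n; case: (odd n); set m := n./2 => /= <-.
  have := bin_mid_odd m; have -> : uphalf (1 + m.*2) = m.+1 by lia.
  by rewrite doubleS add1n => ->; nia.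
have := bin_mid_even m; have -> : uphalf (0 + m.*2) = m by lia.
by rewrite add0n; nia.
Qed.

Lemma bin_mid_shift (r w : nat) :
  2 ^ r * w.+1 * 'C(w, w./2) <= (r + w).+1 * 'C(r + w, (r + w)./2).
Proof.
elim: r => [|r IHr]; first by rewrite expn0 mul1n.
apply: leq_trans (bin_midS _).
by rewrite expnS -!mulnA leq_mul2l /= !mulnA.
Qed.

(** The bound C(n, n/2) >= 2^n / (2 sqrt n), squared to avoid roots; even [n] goes by induction in
    steps of two. *)
Lemma bin_mid_sqr (n : nat) : 0 < n -> 4 ^ n <= 4 * n * 'C(n, n./2) ^ 2.
Proof.
have even_case m : 0 < m -> 4 ^ m.*2 <= 4 * m * 'C(m.*2, m) ^ 2.
  case: m => // m _; elim: m => [//|m IHm].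
  rewrite (_ : m.+2.*2 = m.+1.*2 + 2); last by lia.
  rewrite expnD; apply: leq_trans (leq_mul IHm (leqnn _)) _.
  have := bin_mid_even m.+1; have := bin_mid_odd m.+1.
  rewrite (_ : m.+2.*2 = m.+1.*2 + 2); last by lia.
  move=> ->; move: 'C(_, _) => x; move: 'C(_, _) => y h.
  rewrite -(@leq_pmul2l m.+2) // (_ : _ * (4 * m.+2 * _) = 16 * (m.+2 * x) ^ 2).
    by rewrite h !expnS !expn0; nia.
  by rewrite !expnS !expn0; ring.
move=> n_gt0; have := odd_double_half n; case: (odd n) => /=; set m := n./2 => def_n.
  case: (posnP m) => [m0|m_gt0]; first by rewrite -def_n m0.
  rewrite -def_n add1n expnS; apply: leq_trans (leq_mul (leqnn _) (even_case _ m_gt0)) _.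
  have := bin_mid_even m; move: 'C(_, _) => x; move: 'C(_, _) => y h.
  rewrite -(@leq_pmul2l (m.+1 ^ 2)) ?expn_gt0 //.
  have le_m : 4 * (4 * m * m.+1 ^ 2) <= 4 * m.*2.+1 * m.*2.+1 ^ 2.
    by rewrite !expnS !expn0; nia.
  apply: (@leq_trans (4 * (4 * m * m.+1 ^ 2) * y ^ 2)); first by apply: eq_leq; ring.
  rewrite [leqRHS](_ : _ = 4 * m.*2.+1 * (m.+1 * x) ^ 2); last by ring.
  by rewrite h expnMn (mulnA _ (_ ^ 2)) leq_mul2r le_m orbT.
have m_gt0 : 0 < m by lia.
rewrite -def_n add0n; apply: leq_trans (even_case _ m_gt0) _.
by apply: leq_mul => //; lia.
Qed.

(* Layer cake: both [C(r, a)] and [C(w, b)] are sums of indicators of superlevel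
   sets, which are centred intervals. The map [i |-> (r + w)./2 - i] makes these
   intervals nested, so pairing along it attains the smaller of the two sizes, the
   most any matching can; the total along it is a Vandermonde sum. *)
Lemma sum_bin_matching_le (I : finType) (G : {set I}) (a b : I -> nat) (r w : nat) :
  r <= w -> {in G, forall x, a x <= r} -> {in G, forall x, b x <= w} ->
  {in G &, injective a} -> {in G &, injective b} ->
  \sum_(x in G) 'C(r, a x) * 'C(w, b x) <= 'C(r + w, (r + w)./2).
Proof.
move=> le_rw le_ar le_bw inj_a inj_b; set h := (r + w)./2.
have layer N c : c <= N -> c = \sum_(x < N) (x < c).
  move=> le_cN; rewrite -(big_mkord xpredT (fun x => nat_of_bool (x < c))).
  rewrite (big_cat_nat (n := c)) //= [X in _ + X]big_nat_cond [X in _ + X]big1.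
    rewrite big_nat_cond (eq_bigr (fun=> 1)); last by move=> i /andP[/andP[_ ->]].
    by rewrite -big_nat_cond sum_nat_const_nat subn0 addn0 muln1.
  by move=> i /andP[/andP[le_ci _] _]; rewrite ltnNge le_ci.
pose f := binomial r; pose g := binomial w; pose N := 'C(r, r./2); pose M := 'C(w, w./2).
have layers i j : f i * g j = \sum_(x < N) \sum_(y < M) (x < f i) * (y < g j).
  rewrite {1}(layer N (f i) (bin_le_mid r i)) {1}(layer M (g j) (bin_le_mid w j)) big_distrl /=.
  by apply: eq_bigr => x _; rewrite big_distrr.
have level x y : \sum_(z in G) (x < f (a z)) * (y < g (b z)) <=
    \sum_(i < h.+1) (x < f i) * (y < g (h - i)).
  pose p i := x < f i; pose q j := y < g j.
  have indicator (J : finType) (A : {pred J}) (u v : J -> bool) :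
      \sum_(z in A) u z * v z = #|[set z in A | u z && v z]|.
    rewrite -sum1dep_card [RHS]big_mkcond [LHS]big_mkcond /=; apply: eq_bigr => z _.
    by case: (z \in A); case: (u z); case: (v z).
  rewrite (indicator _ _ (fun z => p (a z)) (fun z => q (b z))).
  rewrite (indicator _ _ (fun i : 'I__ => p i) (fun i : 'I__ => q (h - i))).
  (* The superlevel sets of [f] and [g] are intervals centred at r/2 and w/2. If some [i] in the
     first has h - i outside the second, the second is the shorter one, and reflection by [h] sends
     it into the first. *)
  have nested i j : i <= r -> j <= w -> p i -> q j -> ~~ q (h - i) -> (j <= h) && p (h - j).
    rewrite /p /q /f /g -!leqNgt => le_ir le_jw p_i q_j nq_i.
    have q_dist : (j.*2 - w) + (w - j.*2) < ((h - i).*2 - w) + (w - (h - i).*2).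
      rewrite ltnNge; apply: contraTN (leq_ltn_trans nq_i q_j) => le_dist.
      by rewrite -leqNgt; apply: leq_bin_dist => //; rewrite /h; lia.
    have le_jh : j <= h by move: q_dist; rewrite /h; lia.
    rewrite le_jh; apply: (leq_trans p_i); apply: leq_bin_dist => //; move: q_dist; rewrite /h; lia.
  (* The nested interval supplies the injection into the right-hand side: by [a] if it is that of
     [f], by [h - b] if it is that of [g]. *)
  have [sub_pq | ] := boolP [forall z in G, p (a z) ==> q (h - a z)].
    have le_ah z : z \in G -> a z < h.+1 by move=> /le_ar; rewrite /h; lia.
    rewrite -(@card_in_imset _ _ (fun z => inord (a z) : 'I_h.+1)).
      apply/subset_leq_card/subsetP => _ /imsetP[z] /[!inE] /and3P[Gz p_z q_z] ->.
      apply/and3P; split; rewrite ?inordK ?le_ah //.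
      by have /forall_inP/(_ z Gz)/implyP := sub_pq; apply.
    move=> z1 z2 /[!inE] /and3P[Gz1 _ _] /and3P[Gz2 _ _] /(congr1 val).
    by rewrite /= !inordK ?le_ah //; apply: inj_a.
  case/forall_inPn=> z0 Gz0 /[!negb_imply] /andP[p_z0 nq_z0].
  have le_bh z : z \in G -> q (b z) -> (b z <= h) && p (h - b z).
    by move=> Gz q_z; apply: nested p_z0 q_z nq_z0; [apply: le_ar | apply: le_bw].
  rewrite -(@card_in_imset _ _ (fun z => inord (h - b z) : 'I_h.+1)).
    apply/subset_leq_card/subsetP => _ /imsetP[z] /[!inE] /and3P[Gz p_z q_z] ->.
    have /andP[le_z p_hz] := le_bh z Gz q_z.
    by apply/and3P; split; rewrite ?inordK ?ltnS ?leq_subr ?subKn.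
  move=> z1 z2 /[!inE] /and3P[Gz1 _ q1] /and3P[Gz2 _ q2] /(congr1 val).
  rewrite /= !inordK ?ltnS ?leq_subr // => eq_b; apply: inj_b => //.
  by have := le_bh _ Gz1 q1; have := le_bh _ Gz2 q2; lia.
rewrite -binomial.Vandermonde (eq_bigr _ (fun z _ => layers (a z) (b z))).
rewrite [leqRHS](eq_bigr _ (fun (i : 'I_h.+1) _ => layers i (h - i))).
rewrite exchange_big [leqRHS]exchange_big; apply: leq_sum => x _.
by rewrite exchange_big [leqRHS]exchange_big; apply: leq_sum => y _.
Qed.

(** * Averaging over random grids *)

Lemma card_set_sum (T : finType) (A : {pred T}) (P : pred T) :
  #|[set x in A | P x]| = \sum_(x in A) P x.
Proof.
rewrite -sum1dep_card [LHS]big_mkcond [RHS]big_mkcond /=; apply: eq_bigr => x _.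
by case: (x \in A); case: (P x).
Qed.

(* A uniform [g] in [Om] is a random grid in which every element of [V] occurs with
   probability [1 / wt]. Deleting from [F] on the grid the upper end of every
   [e]-pair leaves an [e]-free set; the expected deleted weight is at most
   [d / q] per element of [F]. *)
Lemma averaged_supersaturation (V O : finType) (Om : {set O}) (grid : O -> pred V)
    (e : rel V) (wt : V -> nat) (F : {set V}) (q d K : nat) :
  0 < #|Om| ->
  {in F, forall B, #|[set g in Om | grid g B]| * wt B = #|Om|} ->
  {in F &, forall A B, e A B ->
    q * #|[set g in Om | grid g A && grid g B]| <= #|[set g in Om | grid g B]|} ->
  {in Om, forall g, forall G : {set V}, {in G, forall B, grid g B} ->
    {in G &, forall A B, ~~ e A B} -> \sum_(B in G) wt B <= K} ->
  {in F, forall B, #|[set A in F | e A B]| <= d} ->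
  q * #|F| <= q * K + d * #|F|.
Proof.
move=> Om_gt0 card_grid card_grid2 le_K le_d.
(* Each member of [F] has expected weight exactly 1 on a random grid. *)
have sum_wt : \sum_(g in Om) \sum_(B in F) grid g B * wt B = #|Om| * #|F|.
  rewrite exchange_big (eq_bigr (fun=> #|Om|)) ?sum_nat_const 1?mulnC // => B FB.
  by rewrite -big_distrl /= -card_set_sum /= card_grid.
have bound_g g : g \in Om -> \sum_(B in F) grid g B * wt B <=
    K + \sum_(B in F) \sum_(A in F) (e A B && (grid g A && grid g B)) * wt B.
  move=> Om_g; pose G := [set B in F | grid g B & [forall A in F, grid g A ==> ~~ e A B]].
  have GF : G \subset F by apply/subsetP => B; rewrite inE => /and3P[].
  apply: (@leq_trans (\sum_(B in G) wt B +
      \sum_(B in F) \sum_(A in F) (e A B && (grid g A && grid g B)) * wt B)); last first.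
    rewrite leq_add2r; apply: (le_K g) => // [B | A B]; first by rewrite inE => /and3P[].
    rewrite !inE => /and3P[FA gA _] /and3P[_ _ /forall_inP/(_ A FA)/implyP]; exact.
  rewrite (big_setID G) /= (setIidPr GF) [X in _ <= _ + X](big_setID G) /= (setIidPr GF).
  apply: leq_add; first by apply: leq_sum => B; case: (grid g B) => //; rewrite mul1n.
  apply: leq_trans (leq_addl _ _); apply: leq_sum => B; rewrite !inE.
  case gB: (grid g B) => //= /andP[] /[swap] FB; rewrite FB /= => /forall_inPn[A FA].
  rewrite negb_imply negbK => /andP[gA eAB].
  by rewrite (bigD1 A) //= eAB gA /= leq_addr.
rewrite -(@leq_pmul2l #|Om|) // mulnCA -sum_wt mulnDr.
apply: (@leq_trans (q * \sum_(g in Om) (K +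
   \sum_(B in F) \sum_(A in F) (e A B && (grid g A && grid g B)) * wt B))).
  by rewrite leq_mul2l leq_sum ?orbT.
rewrite big_split /= sum_nat_const mulnDr mulnCA leq_add2l.
rewrite exchange_big big_distrr /= (mulnC d) mulnA (mulnC #|Om|) -mulnA -sum_nat_const.
apply: leq_sum => B FB; rewrite exchange_big big_distrr /=.
(* Each [e]-pair below [B] costs expected weight at most 1/q, and there are at most [d] of them. *)
apply: (@leq_trans (\sum_(A in F) e A B * #|Om|)); last first.
  by rewrite -big_distrl /= -card_set_sum mulnC leq_mul2l le_d ?orbT.
apply: leq_sum => A FA; rewrite -big_distrl /=; case eAB: (e A B); last first.
  by rewrite big1 // muln0.
rewrite mul1n -(card_grid B FB) mulnA leq_mul2r -card_set_sum.
by rewrite card_grid2 ?orbT.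
Qed.

(** * Random maximal chains and the grids they span *)

(** Exchanging a point of A \ A' with one of A' \ A shrinks A' \ A, so transpositions within [B]
    connect any two of its subsets of equal size. *)
Lemma swap_invariant (T : finType) (B A A' : {set T}) (phi : {set T} -> nat) :
  (forall (A : {set T}) x y, A \subset B -> x \in B -> y \in B ->
    phi (tperm x y @: A) = phi A) ->
  A \subset B -> A' \subset B -> #|A| = #|A'| -> phi A = phi A'.
Proof.
move=> phi_inv; have [n] := ubnP #|A' :\: A|; elim: n A => // n IHn A lt_n sAB sA'B eqAA'.
have [/eqP|] := eqVneq (A' :\: A) set0.
  by rewrite setD_eq0 => sA'A; congr phi; apply/esym/eqP; rewrite eqEcard sA'A eqAA' leqnn.
case/set0Pn=> y /setDP[A'y nAy].
have : A :\: A' != set0.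
  rewrite setD_eq0; apply/negP => sAA'; have /eqP eqA: A == A' by rewrite eqEcard sAA' eqAA' leqnn.
  by rewrite eqA A'y in nAy.
case/set0Pn=> x /setDP[Ax nA'x].
have Bx : x \in B := subsetP sAB x Ax; have By : y \in B := subsetP sA'B y A'y.
have im_tperm (C : {set T}) z : (z \in tperm x y @: C) = (tperm x y z \in C).
  by rewrite -{1}(tpermK x y z) mem_imset //; apply: perm_inj.
have sB : tperm x y @: A \subset B.
  apply/subsetP => z; rewrite im_tperm; case: tpermP => [->|->|_ _] //; exact: (subsetP sAB).
rewrite -(phi_inv A x y) //; apply: IHn => //; last by rewrite card_imset //; apply: perm_inj.
rewrite -ltnS; apply: leq_trans lt_n.
rewrite (cardsD1 y (A' :\: A)) !inE A'y nAy add1n !ltnS.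
apply/subset_leq_card/subsetP => z; rewrite !inE im_tperm.
by case: tpermP => [->|->|/eqP zx /eqP zy]; rewrite ?Ax ?(negbTE nA'x) ?andbF // zy.
Qed.

(** For [s] uniform among the permutations supported on [U], these sets form a uniformly random
    maximal chain of P(U). *)
Definition chain (T : finType) (U : {set T}) (s : {perm T}) (i : nat) : {set T} :=
  s @: [set x in take i (enum U)].

(** A maximal chain has one set of each size, so membership of [A :&: U] is tested at its own level
    only. *)
Definition on_chain (T : finType) (U : {set T}) (s : {perm T}) (A : {set T}) : bool :=
  chain U s #|A :&: U| == A :&: U.

Lemma card_chain (T : finType) (U : {set T}) s i : i <= #|U| -> #|chain U s i| = i.
Proof.
move=> le_iU; rewrite card_imset; last exact: perm_inj.
rewrite cardsE (card_uniqP _) ?take_uniq ?enum_uniq // size_takel //.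
by rewrite -cardE.
Qed.

Lemma chainS (T : finType) (U : {set T}) s i j : i <= j -> chain U s i \subset chain U s j.
Proof.
move=> le_ij; apply: imsetS; apply/subsetP => x; rewrite !inE.
by rewrite -(take_takel _ le_ij); apply: mem_take.
Qed.

Lemma chain_full (T : finType) (U : {set T}) s : perm_on U s -> chain U s #|U| = U.
Proof.
move=> Us; rewrite /chain take_oversize -?cardE //.
have -> : [set x in enum U] = U by apply/setP => x; rewrite inE mem_enum.
exact: im_perm_on.
Qed.

(** Given that the chain passes through [B], every subset of [B] of size [#|A|] is equally likely to
    be on it: following [s] by a transposition inside [B] keeps [B] on the chain and permutes these
    subsets. *)
Lemma card_chain_pair (T : finType) (U A B : {set T}) :
  A \subset B -> B \subset U ->
  #|[set s | perm_on U s & (chain U s #|A| == A) && (chain U s #|B| == B)]| * 'C(#|B|, #|A|)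
  = #|[set s | perm_on U s & chain U s #|B| == B]|.
Proof.
move=> sAB sBU; set i := #|A|.
pose phi (C : {set T}) :=
  #|[set s | perm_on U s & (chain U s i == C) && (chain U s #|B| == B)]|.
have phi_inv (C : {set T}) x y : C \subset B -> x \in B -> y \in B ->
    phi (tperm x y @: C) = phi C.
  move=> sCB Bx By; set t := tperm x y.
  have Ut : perm_on U t.
    apply/subsetP => z /= tz; have /subsetP/(_ z tz) := tperm_on x y.
    by rewrite !inE => /orP[]/eqP->; apply: (subsetP sBU).
  have tB : t @: B = B.
    apply: im_perm_on; apply/subsetP => z /= tz; have /subsetP/(_ z tz) := tperm_on x y.
    by rewrite !inE => /orP[]/eqP->.
  have tK : involutive (fun D : {set T} => t @: D).
    by move=> D; rewrite -imset_comp -[RHS]imset_id; apply: eq_imset => z /=; apply: tpermK.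
  have chainM s k : chain U (s * t)%g k = t @: chain U s k.
    by rewrite /chain -imset_comp; apply: eq_imset => z /=; rewrite permM.
  rewrite /phi -(card_imset (mem [set s | _ & (chain U s i == C) && _]) (mulIg t)).
  apply: eq_card => s; apply/idP/imsetP => [|[s' ]].
    rewrite inE => /and3P[Us /eqP Ci /eqP CB].
    exists (s * t)%g; last by rewrite -mulgA tperm2 mulg1.
    by rewrite inE perm_onM // !chainM Ci CB tK tB !eqxx.
  rewrite !inE => /and3P[Us /eqP Ci /eqP CB] ->.
  by rewrite perm_onM // !chainM Ci CB tB !eqxx.
have le_AB := subset_leq_card sAB; have le_BU := subset_leq_card sBU.
rewrite -[RHS]sum1_card [RHS](partition_big (fun s => chain U s i) (fun C => (C \subset B) && (#|C| == i))).
  rewrite -cards_draws -[#|[set C : {set T} | _ & _]|]sum1dep_card big_distrr /=.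
  apply: eq_bigr => C /andP[sCB /eqP cardC].
  rewrite muln1 -/(phi A) (swap_invariant (A' := C) phi_inv) //.
  rewrite /phi -sum1_card; apply: eq_bigl => s; rewrite !inE.
  by case: perm_on => //=; rewrite andbC.
move=> s; rewrite inE => /andP[_ /eqP <-].
by rewrite card_chain ?(leq_trans le_AB) // chainS ?eqxx.
Qed.

(** The previous count with the larger set equal to [U], through which every chain passes. *)
Lemma card_on_chain (T : finType) (U A : {set T}) :
  #|[set s | perm_on U s & on_chain U s A]| * 'C(#|U|, #|A :&: U|) = #|[set s | perm_on U s]|.
Proof.
rewrite -[RHS](_ : #|[set s | perm_on U s & chain U s #|U| == U]| = _).
  rewrite -(card_chain_pair (subsetIr A U)) //; congr (_ * _); apply: eq_card => s.
  rewrite !inE /on_chain; case Us: (perm_on U s) => //=.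
  by rewrite chain_full // eqxx andbT.
by apply: eq_card => s; rewrite !inE; case Us: (perm_on U s); rewrite //= chain_full ?eqxx.
Qed.

Lemma card_on_chain2 (T : finType) (U A B : {set T}) : A :&: U \subset B :&: U ->
  #|[set s | perm_on U s & on_chain U s A && on_chain U s B]| * 'C(#|B :&: U|, #|A :&: U|)
  = #|[set s | perm_on U s & on_chain U s B]|.
Proof. by move=> sAB; apply: card_chain_pair => //; apply: subsetIr. Qed.

Lemma on_chain_comparable (T : finType) (U : {set T}) s A B :
  on_chain U s A -> on_chain U s B -> #|A :&: U| <= #|B :&: U| -> A :&: U \subset B :&: U.
Proof. by move=> /eqP eqA /eqP eqB le_AB; rewrite -[A :&: U]eqA -[B :&: U]eqB chainS. Qed.

Definition grids (T : finType) (U V : {set T}) : {set {perm T} * {perm T}} :=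
  setX [set s | perm_on U s] [set t | perm_on V t].

Definition on_grid (T : finType) (U V : {set T}) (g : {perm T} * {perm T}) : pred {set T} :=
  fun A => on_chain U g.1 A && on_chain V g.2 A.

(** The reciprocal of the probability that [A] lies on a random grid, the two chains being
    independent. *)
Definition level_weight (T : finType) (U V A : {set T}) : nat :=
  'C(#|U|, #|A :&: U|) * 'C(#|V|, #|A :&: V|).

Lemma card_grids_gt0 (T : finType) (U V : {set T}) : 0 < #|grids U V|.
Proof. by apply/card_gt0P; exists (1%g, 1%g); rewrite !inE !perm_on1. Qed.

Lemma card_on_grid (T : finType) (U V A : {set T}) :
  #|[set g in grids U V | on_grid U V g A]| * level_weight U V A = #|grids U V|.
Proof.
rewrite [RHS]cardsX -(card_on_chain U A) -(card_on_chain V A) mulnACA -cardsX.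
by congr (_ * _); apply: eq_card => g; rewrite !inE andbACA.
Qed.

(** A difference inside one part leaves the traces on the other part equal, so putting [A] on the
    grid as well constrains one chain only. *)
Lemma card_on_grid2 (T : finType) (U V A B : {set T}) (q : nat) :
  A \subset B ->
  (B :\: A \subset V /\ q <= 'C(#|B :&: V|, #|A :&: V|)) \/
  (B :\: A \subset U /\ q <= 'C(#|B :&: U|, #|A :&: U|)) -> [disjoint U & V] ->
  q * #|[set g in grids U V | on_grid U V g A && on_grid U V g B]|
    <= #|[set g in grids U V | on_grid U V g B]|.
Proof.
move=> sAB le_q dis_UV.
have -> : #|[set g in grids U V | on_grid U V g A && on_grid U V g B]| =
    #|[set s | perm_on U s & on_chain U s A && on_chain U s B]| *
    #|[set s | perm_on V s & on_chain V s A && on_chain V s B]|.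
  rewrite -cardsX; apply: eq_card => g; rewrite !inE /on_grid.
  by rewrite [X in _ && X = _]andbACA [RHS]andbACA.
have -> : #|[set g in grids U V | on_grid U V g B]| =
    #|[set s | perm_on U s & on_chain U s B]| * #|[set s | perm_on V s & on_chain V s B]|.
  by rewrite -cardsX; apply: eq_card => g; rewrite !inE andbACA.
have fixed (X Y : {set T}) : [disjoint X & Y] -> B :\: A \subset Y ->
    #|[set s | perm_on X s & on_chain X s A && on_chain X s B]| =
    #|[set s | perm_on X s & on_chain X s B]|.
  move=> dis_XY sDY; apply: eq_card => s; rewrite !inE /on_chain.
  suff -> : A :&: X = B :&: X by rewrite andbb.
  apply/setP => x; rewrite !inE; case Ax: (x \in A); first by rewrite (subsetP sAB).
  case Bx: (x \in B) => //=; apply/esym/negbTE; rewrite (disjointFl dis_XY) //.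
  by apply: (subsetP sDY); rewrite inE Ax Bx.
have moved (X : {set T}) : q <= 'C(#|B :&: X|, #|A :&: X|) ->
    q * #|[set s | perm_on X s & on_chain X s A && on_chain X s B]| <=
    #|[set s | perm_on X s & on_chain X s B]|.
  by move=> le_C; rewrite -(card_on_chain2 (setSI X sAB)) mulnC leq_mul2l le_C orbT.
case: le_q => -[sD /moved le_q].
  by rewrite (fixed U V) // mulnCA leq_mul2l le_q orbT.
by rewrite (fixed V U) 1?disjoint_sym // mulnA leq_mul2r le_q orbT.
Qed.

Lemma on_grid_same_level (T : finType) (U V : {set T}) g (A B : {set T}) :
  U :|: V = setT -> on_chain U g.1 A && on_chain V g.2 A -> on_chain U g.1 B && on_chain V g.2 B ->
  #|A :&: U| = #|B :&: U| -> #|A :&: V| <= #|B :&: V| -> A \subset B /\ B :\: A \subset V.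
Proof.
move=> UV /andP[UA VA] /andP[UB VB] eqU leV.
have sU := on_chain_comparable UA UB (eq_leq eqU).
have sU' := on_chain_comparable UB UA (eq_leq (esym eqU)).
have sV := on_chain_comparable VA VB leV.
have inUV x : (x \in U) || (x \in V) by move/setP/(_ x): UV; rewrite !inE.
split; apply/subsetP => x; rewrite ?inE.
  move=> Ax; have /orP[Ux|Vx] := inUV x.
    by have := subsetP sU x; rewrite !inE Ax Ux => /(_ isT)/andP[].
  by have := subsetP sV x; rewrite !inE Ax Vx => /(_ isT)/andP[].
case/andP=> nAx Bx; have /orP[Ux|//] := inUV x.
by have := subsetP sU' x; rewrite !inE Bx Ux (negbTE nAx) => /(_ isT).
Qed.

(** Two grid members on the same level of the [U]-chain agree on [U] and are nested on [V], so they
    would form a forbidden pair. *)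
Lemma on_grid_inj (T : finType) (U V : {set T}) g (G : {set {set T}}) :
  U :|: V = setT -> {in G, forall B : {set T}, on_chain U g.1 B && on_chain V g.2 B} ->
  {in G &, forall A B : {set T}, ~~ ((A \proper B) && (B :\: A \subset V))} ->
  {in G &, injective (fun B : {set T} => #|B :&: U|)}.
Proof.
move=> UV gridG freeG A B; wlog leAB : A B / #|A :&: V| <= #|B :&: V|.
  move=> IH GA GB eqAB; case: (leqP #|A :&: V| #|B :&: V|) => [/IH|/ltnW/IH]; first exact.
  by move/(_ GB GA (esym eqAB)).
move=> GA GB /= eqAB; have [sAB sD] := on_grid_same_level UV (gridG A GA) (gridG B GB) eqAB leAB.
apply/eqP; rewrite eqEsubset sAB /=; apply: contraR (freeG A B GA GB) => nsBA.
by rewrite properE sAB nsBA sD.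
Qed.

(** * Supersaturation for a fixed colouring *)

Lemma card_two_colouring n (R W : {set 'I_n}) : two_colouring R W -> #|R| + #|W| = n.
Proof.
move=> /andP[/eqP RW dis_RW].
by rewrite -[n in RHS]card_ord -cardsT -RW cardsU disjoint_setI0 // cards0 subn0.
Qed.

(** With both colours forbidden, a free family on a grid is injective in both coordinates, so the
    matching bound applies. *)
Lemma two_part_supersaturation n (R W : {set 'I_n}) (F : {set {set 'I_n}}) (q d : nat) :
  two_colouring R W ->
  {in F &, forall A B : {set 'I_n}, A \proper B -> B :\: A \subset R -> q <= 'C(#|B :&: R|, #|A :&: R|)} ->
  {in F &, forall A B : {set 'I_n}, A \proper B -> B :\: A \subset W -> q <= 'C(#|B :&: W|, #|A :&: W|)} ->
  {in F, forall B : {set 'I_n}, #|[set A : {set 'I_n} in F | comparable_mono_diff R W A B]| <= d} ->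
  q * #|F| <= q * 'C(n, n./2) + d * #|F|.
Proof.
move=> col; have card_RW := card_two_colouring col.
case/andP: col => /eqP RW dis_RW le_qR le_qW le_d.
apply: (averaged_supersaturation (grid := on_grid R W) (wt := level_weight R W)) le_d => //.
- exact: (card_grids_gt0 R W).
- by move=> B _; apply: card_on_grid.
- move=> A B FA FB /andP[pAB /orP[sD|sD]]; apply: card_on_grid2 => //;
    by [exact: proper_sub | right; split => //; exact: le_qR | left; split => //; exact: le_qW].
move=> g _ G gridG freeG.
have injR : {in G &, injective (fun B : {set 'I_n} => #|B :&: R|)}.
  apply: on_grid_inj RW gridG _ => A B GA GB; apply: contra (freeG A B GA GB).
  by case/andP=> pAB sD; rewrite /comparable_mono_diff pAB sD orbT.
have injW : {in G &, injective (fun B : {set 'I_n} => #|B :&: W|)}.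
  apply: (@on_grid_inj _ W R (g.2, g.1)) => [|B GB|A B GA GB]; first by rewrite setUC.
    by rewrite andbC; apply: gridG.
  apply: contra (freeG A B GA GB).
  by case/andP=> pAB sD; rewrite /comparable_mono_diff pAB sD.
have le_card (X : {set 'I_n}) : {in G, forall B : {set 'I_n}, #|B :&: X| <= #|X|}.
  by move=> B _; rewrite subset_leq_card ?subsetIr.
(* The matching bound expects the smaller class first. *)
case/orP: (leq_total #|R| #|W|) => le_RW.
  by have := sum_bin_matching_le le_RW (le_card R) (le_card W) injR injW; rewrite card_RW.
have := sum_bin_matching_le le_RW (le_card W) (le_card R) injW injR.
by rewrite addnC card_RW; under eq_bigr => B _ do rewrite mulnC.
Qed.

(** Here only the [R]-level is injective. Bounding the [W]-factor of each weight by its maximum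
    leaves a sum of distinct C(r, i), at most 2^r. *)
Lemma one_part_supersaturation n (R W : {set 'I_n}) (F : {set {set 'I_n}}) (q d : nat) :
  two_colouring R W ->
  {in F &, forall A B : {set 'I_n}, A \proper B -> B :\: A \subset W -> q <= 'C(#|B :&: W|, #|A :&: W|)} ->
  {in F, forall B : {set 'I_n}, #|[set A : {set 'I_n} in F | (A \proper B) && (B :\: A \subset W)]| <= d} ->
  q * #|F| <= q * (2 ^ #|R| * 'C(#|W|, #|W|./2)) + d * #|F|.
Proof.
move=> /andP[/eqP RW dis_RW] le_qW le_d.
apply: (averaged_supersaturation (grid := on_grid R W) (wt := level_weight R W)) le_d => //.
- exact: (card_grids_gt0 R W).
- by move=> B _; apply: card_on_grid.
- move=> A B FA FB /andP[pAB sD]; apply: card_on_grid2 => //; first exact: proper_sub.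
  by left; split => //; apply: le_qW.
move=> g _ G gridG freeG.
have injR := on_grid_inj RW gridG freeG.
apply: (@leq_trans (\sum_(B in G) 'C(#|R|, #|B :&: R|) * 'C(#|W|, #|W|./2))).
  by apply: leq_sum => B _; rewrite leq_mul2l bin_le_mid orbT.
rewrite -big_distrl leq_mul2r /=; apply/orP; right.
pose lev (B : {set 'I_n}) : 'I_#|R|.+1 := inord #|B :&: R|.
have val_lev B : lev B = #|B :&: R| :> nat by rewrite inordK // ltnS subset_leq_card ?subsetIr.
have -> : 2 ^ #|R| = \sum_(i < #|R|.+1) 'C(#|R|, i).
  by rewrite -[2]/(1 + 1) Pascal; apply: eq_bigr => i _; rewrite !exp1n !muln1.
have inj_lev : {in G &, injective lev}.
  by move=> A B GA GB /(congr1 val); rewrite /= !val_lev; apply: injR.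
rewrite (eq_bigr (fun B => 'C(#|R|, lev B))); last by move=> B _; rewrite val_lev.
rewrite -(big_imset (fun i : 'I__ => 'C(#|R|, i)) inj_lev) /=.
by rewrite [leqRHS](bigID (mem (lev @: G))) leq_addr.
Qed.

(** * Counting pair-free sets by branching *)

Lemma leq_exp2rW (m n e : nat) : m <= n -> m ^ e <= n ^ e.
Proof. by case: e => [|e] le_mn //; rewrite leq_exp2r. Qed.

Definition pair_free (V : finType) (e : rel V) (F : {set V}) : bool :=
  [forall A in F, forall B in F, ~~ e A B].

Lemma pair_free_subset (V : finType) (e : rel V) (F G : {set V}) :
  F \subset G -> pair_free e G -> pair_free e F.
Proof.
move=> /subsetP sFG /forall_inP freeG; apply/forall_inP => A /sFG GA.
by apply/forall_inP => B /sFG GB; have /forall_inP := freeG A GA; apply.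
Qed.

(* A vertex of in-degree at least [d] gives [i(S) <= i(S - v) + i(S - v - N(v))];
   [x = 1 + 1/t] satisfies [x ^ (d + 1) >= x ^ d + 1], so [i(S)] grows at most like
   [x ^ #|S|] once [#|S| > m]. *)
Lemma card_pair_free_le (V : finType) (e : rel V) (m d t : nat) (S : {set V}) :
  irreflexive e -> t ^ d.+1 <= t.+1 ^ d ->
  (forall X : {set V}, m < #|X| -> exists2 v, v \in X & d <= #|[set u in X | e u v]|) ->
  #|[set F : {set V} | F \subset S & pair_free e F]| * t ^ #|S| <= 2 ^ m * t.+1 ^ #|S|.
Proof.
move=> e_irr le_td big_deg.
have [N] := ubnP #|S|; elim: N S => // N IHN S le_SN.
case: (leqP #|S| m) => [le_Sm | lt_mS].
  apply: leq_mul; last exact: leq_exp2rW.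
  apply: leq_trans (leq_pexp2l _ le_Sm) => //; rewrite -card_powerset.
  by apply/subset_leq_card/subsetP => F; rewrite !inE => /andP[].
have [v Sv le_d] := big_deg S lt_mS.
set Nv := [set u in S | e u v] in le_d.
pose S1 := S :\ v; pose S2 := S1 :\: Nv.
have sNS1 : Nv \subset S1.
  apply/subsetP => u; rewrite !inE => /andP[-> euv]; rewrite andbT.
  by apply: contraTneq euv => ->; rewrite e_irr.
have card_S : #|S| = #|S1|.+1 by rewrite (cardsD1 v) Sv.
have card_S1 : #|S1| = #|Nv| + #|S2| by rewrite -(cardsID Nv S1) (setIidPr sNS1).
set I := [set F : {set V} | F \subset S & pair_free e F].
have le_I : #|I| <= #|[set F : {set V} | F \subset S1 & pair_free e F]| +
                    #|[set F : {set V} | F \subset S2 & pair_free e F]|.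
  rewrite -(cardsID [set F : {set V} | v \in F] I) addnC; apply: leq_add.
    apply/subset_leq_card/subsetP => F; rewrite !inE => /and3P[nFv sFS freeF].
    by rewrite freeF andbT subsetD1 sFS.
  (* A pair-free set containing [v] avoids [Nv], and is recovered after deleting [v]. *)
  rewrite -(card_in_imset (f := fun F : {set V} => F :\ v)).
    apply/subset_leq_card/subsetP => _ /imsetP[F] /[!inE] /andP[/andP[sFS freeF] Fv] ->.
    rewrite (pair_free_subset (subD1set F v)) // andbT; apply/subsetP => u.
    rewrite !inE => /andP[neq_uv Fu]; rewrite neq_uv (subsetP sFS) //= !andbT.
    by have /forall_inP/(_ u Fu)/forall_inP := freeF; apply.
  move=> F1 F2; rewrite !inE => /andP[_ Fv1] /andP[_ Fv2] eqF.
  by rewrite -(setD1K Fv1) -(setD1K Fv2) eqF.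
have IH1 := IHN S1 ltac:(lia); have IH2 := IHN S2 ltac:(lia).
move: le_I IH1 IH2; set i1 := #|[set F : {set V} | F \subset S1 & _]|.
set i2 := #|[set F : {set V} | F \subset S2 & _]|; move: #|I| => i le_i IH1 IH2.
apply: (@leq_trans ((i1 + i2) * t ^ #|S|)); first by rewrite leq_mul2r le_i orbT.
have le_tN : t ^ #|Nv|.+1 <= t.+1 ^ #|Nv|.
  rewrite -(subnK le_d) -addnS !expnD leq_mul //; apply: leq_exp2rW; lia.
rewrite mulnDl card_S [in X in _ <= X]expnS mulnCA mulSn addnC; apply: leq_add.
  rewrite card_S1 -addSn expnD mulnCA.
  apply: (@leq_trans (t ^ #|Nv|.+1 * (2 ^ m * t.+1 ^ #|S2|))).
    by rewrite leq_mul2l IH2 orbT.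
  by rewrite expnD mulnCA leq_mul2l leq_mul2r le_tN !orbT.
by rewrite expnS mulnCA leq_mul2l IH1 orbT.
Qed.

(** Bernoulli's inequality (1 - 1/(t+1))^j >= 1 - j/(t+1), cleared of denominators. *)
Lemma leq_bernoulli (t j : nat) : j <= t.+1 -> t.+1 ^ j * (t.+1 - j) <= t ^ j * t.+1.
Proof.
elim: j => [|j IHj] le_jt; first by rewrite subn0.
have {}IHj := IHj (ltnW le_jt).
apply: (@leq_trans (t * (t.+1 ^ j * (t.+1 - j)))); last by rewrite expnS -mulnA leq_mul2l IHj orbT.
rewrite [leqRHS]mulnCA expnSr -mulnA leq_mul2l; apply/orP; right.
rewrite subSS (_ : t.+1 - j = (t - j).+1); last by lia.
by rewrite mulnS mulSn leq_add2r leq_subr.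
Qed.

(** With t = 2u, Bernoulli gives (1 + 1/t)^u <= 2, hence (1 + 1/t)^N <= 2^c. *)
Lemma leq_expS_double (u c N i m : nat) : 0 < u -> N <= u * c ->
  i * u.*2 ^ N <= 2 ^ m * u.*2.+1 ^ N -> i <= 2 ^ (m + c).
Proof.
move=> u_gt0 le_N le_i; set t := u.*2 in le_i *.
have t_gt0 : 0 < t by rewrite double_gt0.
have le_u : t.+1 ^ u <= 2 * t ^ u.
  rewrite -(@leq_pmul2r (t.+1 - u)); last by lia.
  apply: leq_trans (leq_bernoulli _) _; first by lia.
  by rewrite -mulnA mulnCA leq_mul2l; apply/orP; right; lia.
have le_uc : t.+1 ^ (u * c) <= 2 ^ c * t ^ (u * c).
  rewrite !expnM -expnMn; exact: leq_exp2rW.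
rewrite -(@leq_pmul2r (t ^ (u * c))) ?expn_gt0 ?t_gt0 // expnD -mulnA.
apply: leq_trans (leq_mul (leqnn _) le_uc); rewrite -(subnKC le_N) !expnD !mulnA.
by apply: leq_mul le_i _; apply: leq_exp2rW.
Qed.

(** The quadratic term C(d, 2) t^(d-2) of (t + 1)^d already suffices. *)
Lemma leq_exp_binomial (t d : nat) : 2 * t ^ 3 <= d * d.-1 -> t ^ d.+1 <= t.+1 ^ d.
Proof.
case: d => [|[|d]] le_td.
- by have -> : t = 0 by case: t le_td.
- by have -> : t = 0 by case: t le_td.
have -> : t.+1 ^ d.+2 = \sum_(i < d.+3) 'C(d.+2, i) * t ^ (d.+2 - i).
  by rewrite -addn1 Pascal; apply: eq_bigr => i _; rewrite exp1n muln1.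
have i2 : 2 < d.+3 by [].
rewrite (bigD1 (Ordinal i2)) //=; apply: leq_trans (leq_addr _ _).
rewrite (_ : d.+2 - 2 = d); last by lia.
rewrite (_ : d.+3 = 3 + d) // expnD leq_mul2r; apply/orP; right.
have := bin_ffact d.+2 2; rewrite !ffactnS ffactn0 muln1 (_ : 2`! = 2) //= => eqC.
by move: le_td; rewrite /= -eqC mulnC leq_pmul2r.
Qed.

(** * Most sets are balanced on a large colour class *)

Lemma card_all_sets (T : finType) : #|{: {set T}}| = 2 ^ #|T|.
Proof. by rewrite -(cardsT T) -card_powerset powersetT cardsT. Qed.

(** The variance of a sum of [#|U|] independent signs. Flipping the membership of one point [x]
    negates its sign [s] and preserves the remainder [D], so the cross terms cancel. *)
Lemma sum_imbalance_sqr (T : finType) (U : {set T}) :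
  (\sum_(B : {set T}) (#|U|%:Z - 2 * #|B :&: U|%:Z) ^+ 2 = #|U|%:Z * (2 ^ #|T|)%:Z)%R.
Proof.
have [N] := ubnP #|U|; elim: N U => // N IHN U lt_UN.
have [->|/set0Pn[x Ux]] := eqVneq U set0.
  by rewrite cards0 mul0r big1 // => B _; rewrite setI0 cards0.
pose U' := U :\ x; have cardU : #|U| = #|U'|.+1 by rewrite (cardsD1 x) Ux.
have IH := IHN U' ltac:(lia).
pose D (B : {set T}) : int := (#|U'|%:Z - 2 * #|B :&: U'|%:Z)%R.
pose s (B : {set T}) : int := (1 - 2 * (x \in B)%:Z)%R.
have splitD B : (#|U|%:Z - 2 * #|B :&: U|%:Z = D B + s B)%R.
  have -> : #|B :&: U| = (x \in B) + #|B :&: U'|.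
    rewrite (cardsD1 x) inE Ux andbT; congr (_ + _); apply: eq_card => y.
    by rewrite !inE andbCA.
  by rewrite cardU /D /s; lia.
pose flip (B : {set T}) := if x \in B then B :\ x else x |: B.
have flipK : involutive flip.
  move=> B; rewrite /flip; case Bx: (x \in B); first by rewrite setD11 setD1K.
  by rewrite setU11 setU1K // Bx.
have flipE (B : {set T}) y : (y \in flip B) = if y == x then x \notin B else y \in B.
  by rewrite /flip; case: ifP => Bx; rewrite !inE; case: eqVneq => [->|].
have D_flip B : D (flip B) = D B.
  congr (_ - 2 * Posz _)%R; apply: eq_card => y; rewrite !inE flipE.
  by case: eqVneq => //=; rewrite !andbF.
have s_flip B : (s (flip B) = - s B)%R by rewrite /s flipE eqxx; case: (x \in B).
have sqr_s B : (s B ^+ 2 = 1)%R by rewrite /s; case: (x \in B).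
under eq_bigr => B _ do rewrite splitD.
apply: (@mulfI _ 2%R) => //.
rewrite mulrDl mul1r {1}(reindex_inj (inv_inj flipK)) -big_split /=.
rewrite (eq_bigr (fun B => 2 * D B ^+ 2 + 2)%R); last first.
  move=> B _; rewrite D_flip s_flip.
  have -> : ((D B - s B) ^+ 2 + (D B + s B) ^+ 2 = 2 * D B ^+ 2 + 2 * s B ^+ 2)%R by ring.
  by rewrite sqr_s mulr1.
rewrite big_split /= -big_distrr /= IH sumr_const.
have -> := card_all_sets T.
by rewrite cardU -mulr_natr natz intS; ring.
Qed.

(** Chebyshev's inequality: each counted set has imbalance above [#|U|]/2. *)
Lemma card_unbalanced_le (T : finType) (U : {set T}) :
  #|[set B : {set T} | 4 * #|B :&: U| < #|U|]| * #|U| <= 4 * 2 ^ #|T|.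
Proof.
have [->|U_gt0] := posnP #|U|; first by rewrite muln0.
set X := [set B | _]; set u := #|U| in U_gt0 *.
rewrite -(@leq_pmul2r u) // -lez_nat.
have := sum_imbalance_sqr U; rewrite -/u => sum_eq.
have -> : Posz (4 * 2 ^ #|T| * u) = (4 * (u%:Z * (2 ^ #|T|)%:Z))%R by rewrite !PoszM; ring.
rewrite -sum_eq (bigID (mem X)) /= mulrDr.
apply: (@le_trans _ _ (4 * \sum_(B in X) (u%:Z - 2 * #|B :&: U|%:Z) ^+ 2)%R); last first.
  by rewrite lerDl mulr_ge0 // sumr_ge0 // => B _; apply: sqr_ge0.
rewrite big_distrr /= -mulnA PoszM -[Posz #|X|]natz mulr_natl -sumr_const.
apply: ler_sum => B; rewrite inE -/u => ltB.
by rewrite PoszM; nia.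
Qed.

(** * Size of families with small in-degrees *)

Lemma leq_bin_inner (n k : nat) : 0 < k < n -> n <= 'C(n, k).
Proof. by move=> k_n; rewrite -{1}(bin1 n); apply: leq_bin_dist; lia. Qed.

Lemma two_colouringC n (R W : {set 'I_n}) : two_colouring R W = two_colouring W R.
Proof. by rewrite /two_colouring setUC disjoint_sym. Qed.

Lemma comparable_mono_diffC n (R W A B : {set 'I_n}) :
  comparable_mono_diff R W A B = comparable_mono_diff W R A B.
Proof. by rewrite /comparable_mono_diff orbC. Qed.

(** The trace of [A] on [X] is nonempty and strictly inside that of [B], so the coefficient is at
    least [#|B :&: X|] >= [#|X|]/4 >= n/(4k) >= q. *)
Lemma proper_bin_lower_bound (T : finType) (X A B : {set T}) (n k q : nat) :
  0 < n -> 4 * (k * q) <= n -> n <= k * #|X| ->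
  #|X| <= 4 * #|A :&: X| -> #|X| <= 4 * #|B :&: X| -> A \proper B -> B :\: A \subset X ->
  q <= 'C(#|B :&: X|, #|A :&: X|).
Proof.
move=> n_gt0 le_qn le_nX le_XA le_XB; case/properP=> sAB [x Bx nAx] sD.
have Xx : x \in X by apply: (subsetP sD); rewrite inE nAx.
have lt_AB : #|A :&: X| < #|B :&: X|.
  apply/proper_card/properP; split; first exact: setSI.
  by exists x; rewrite inE ?Bx // (negbTE nAx).
have X_gt0 : 0 < #|X| by apply/card_gt0P; exists x.
apply: leq_trans (leq_bin_inner _); last by lia.
have k_gt0 : 0 < k by nia.
by rewrite -(@leq_pmul2l (4 * k)) ?muln_gt0 //; nia.
Qed.

Lemma sparse_balanced_family_le n (R W : {set 'I_n}) (F : {set {set 'I_n}}) (k d : nat) :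
  1 < k -> 0 < d -> 4 * (k * (k * d)) <= n -> two_colouring R W ->
  (forall X, X = R \/ X = W -> n <= k * #|X| -> {in F, forall B : {set 'I_n}, #|X| <= 4 * #|B :&: X|}) ->
  {in F, forall B : {set 'I_n}, #|[set A in F | comparable_mono_diff R W A B]| <= d} ->
  k.-1 ^ 2 * #|F| <= k ^ 2 * 'C(n, n./2).
Proof.
move=> k_gt1 d_gt0 le_dn; wlog le_RW : R W / #|R| <= #|W|.
  move=> IH RW bal deg; case: (leqP #|R| #|W|) => [le_RW|/ltnW le_WR]; first exact: (IH R W).
  apply: (IH W R) => //; first by rewrite two_colouringC.
    by move=> X [->|->]; apply: bal; [right | left].
  move=> B FB; rewrite (eq_card (B := mem [set A in F | comparable_mono_diff R W A B])) ?deg //.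
  by move=> A; rewrite !inE comparable_mono_diffC.
move=> RW bal deg; have n_gt0 : 0 < n by nia.
have card_RW := card_two_colouring RW.
have le_nW : n <= k * #|W| by nia.
(* Supersaturation is used with q = k d, so the error term is a fraction 1/k of [#|F|]. *)
have cancel_d K : k * d * #|F| <= k * d * K + d * #|F| -> k.-1 * #|F| <= k * K.
  move=> le_K; rewrite -(@leq_pmul2l d) // -(leq_add2r (d * #|F|)).
  apply: leq_trans (_ : _ <= k * d * #|F|) _; last by apply: leq_trans le_K _; lia.
  by rewrite -mulnDr -mulSnr prednK ?(ltnW k_gt1) //; lia.
have binW : {in F &, forall A B : {set 'I_n}, A \proper B -> B :\: A \subset W ->
    k * d <= 'C(#|B :&: W|, #|A :&: W|)}.
  have balW := bal W (or_intror erefl) le_nW.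
  by move=> A B FA FB; apply: (proper_bin_lower_bound n_gt0 le_dn le_nW); apply: balW.
have [le_nR | lt_Rn] := leqP n (k * #|R|).
  have binR : {in F &, forall A B : {set 'I_n}, A \proper B -> B :\: A \subset R ->
      k * d <= 'C(#|B :&: R|, #|A :&: R|)}.
    have balR := bal R (or_introl erefl) le_nR.
    by move=> A B FA FB; apply: (proper_bin_lower_bound n_gt0 le_dn le_nR); apply: balR.
  by have := cancel_d _ (two_part_supersaturation RW binR binW deg); nia.
(* Now [R] has fewer than n/k points. Using [W] alone costs another factor k/(k-1), from
   [bin_mid_shift]; hence the squares in the conclusion. *)
have deg' : {in F, forall B : {set 'I_n}, #|[set A in F | (A \proper B) && (B :\: A \subset W)]| <= d}.
  move=> B FB; apply: leq_trans (deg B FB); apply/subset_leq_card/subsetP => A.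
  by rewrite !inE => /and3P[-> pAB sD]; rewrite /comparable_mono_diff pAB sD orbT.
have := cancel_d _ (one_part_supersaturation RW binW deg').
have := bin_mid_shift #|R| #|W|; rewrite card_RW.
set M := 'C(n, _); set c := 'C(#|W|, _); set p := 2 ^ _ => le_M le_F.
have le_pc : k.-1 * (p * c) <= k * M.
  rewrite -(@leq_pmul2l n.+1) //; apply: (@leq_trans (k * (p * #|W|.+1 * c))); last first.
    by rewrite [leqRHS]mulnCA leq_mul2l le_M orbT.
  have : n.+1 * k.-1 <= k * #|W|.+1 by nia.
  by move: (p * c) (p * _ * c) (mulnAC p #|W|.+1 c) => x y ->; nia.
by rewrite -mulnn -mulnA; nia.
Qed.

(** Sets unbalanced on a class of size at least n/k are discarded; there are at most 4k 2^n / n of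
    them for each class. *)
Lemma sparse_family_le n (R W : {set 'I_n}) (F : {set {set 'I_n}}) (k d : nat) :
  1 < k -> 0 < d -> 4 * (k * (k * d)) <= n -> two_colouring R W ->
  {in F, forall B : {set 'I_n}, #|[set A in F | comparable_mono_diff R W A B]| <= d} ->
  #|F| <= (k ^ 2 * 'C(n, n./2)) %/ k.-1 ^ 2 + (8 * k * 2 ^ n) %/ n.
Proof.
move=> k_gt1 d_gt0 le_dn RW deg; have n_gt0 : 0 < n by nia.
pose unb (X : {set 'I_n}) := [set B : {set 'I_n} | (n <= k * #|X|) && (4 * #|B :&: X| < #|X|)].
have card_unb X : n * #|unb X| <= 4 * k * 2 ^ n.
  have [le_nX | lt_Xn] := leqP n (k * #|X|); last first.
    by rewrite (_ : unb X = set0) ?cards0 ?muln0 //; apply/setP => B; rewrite !inE leqNgt lt_Xn.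
  have := card_unbalanced_le X; rewrite card_ord.
  rewrite (_ : [set B | _] = unb X); last by apply/setP => B; rewrite !inE le_nX.
  move=> le_unb; apply: (@leq_trans (k * #|X| * #|unb X|)); first by rewrite leq_mul2r le_nX orbT.
  by rewrite -mulnA (mulnC #|X|) (mulnC 4) -mulnA leq_mul2l le_unb orbT.
pose F' := F :\: (unb R :|: unb W).
have bal X : X = R \/ X = W -> n <= k * #|X| -> {in F', forall B : {set 'I_n}, #|X| <= 4 * #|B :&: X|}.
  move=> RWX le_nX B; rewrite !inE negb_or !negb_and => /andP[/andP[nR nW] _]; rewrite leqNgt.
  by case: RWX => eqX; rewrite eqX in le_nX *; [move: nR | move: nW]; rewrite le_nX.
have deg' : {in F', forall B : {set 'I_n}, #|[set A in F' | comparable_mono_diff R W A B]| <= d}.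
  move=> B /setDP[FB _]; apply: leq_trans (deg B FB); apply/subset_leq_card/subsetP => A.
  by rewrite inE => /andP[/setDP[FA _]]; rewrite inE FA.
have le_F' := sparse_balanced_family_le k_gt1 d_gt0 le_dn RW bal deg'.
rewrite -(cardsID (unb R :|: unb W) F) addnC -/F'; apply: leq_add.
  by rewrite leq_divRL 1?mulnC // expn_gt0; lia.
apply: leq_trans (subset_leq_card (subsetIr _ _)) _.
rewrite leq_divRL //; apply: (@leq_trans (n * #|unb R| + n * #|unb W|)).
  by rewrite -mulnDr mulnC leq_mul2l (leq_card_setU (unb R)) orbT.
by have := card_unb R; have := card_unb W; lia.
Qed.

(** * Upper and lower bounds for the number of families *)

(** Any family larger than the sparse bound has a member of in-degree at least d + 1, so branching
    applies with t = 2u; its growth over all 2^n sets costs [c] in the exponent. *)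
Lemma card_mono_diff_free_le n (R W : {set 'I_n}) (k d u c : nat) :
  1 < k -> 0 < d -> 4 * (k * (k * d)) <= n -> two_colouring R W ->
  0 < u -> 2 * u.*2 ^ 3 <= d.+1 * d -> 2 ^ n <= u * c ->
  #|[set F | mono_diff_free R W F]| <=
    2 ^ ((k ^ 2 * 'C(n, n./2)) %/ k.-1 ^ 2 + (8 * k * 2 ^ n) %/ n + c).
Proof.
move=> k_gt1 d_gt0 le_dn RW u_gt0 le_ud le_nu.
set m := _ %/ _ + _; apply: leq_expS_double u_gt0 le_nu _.
have irr : irreflexive (comparable_mono_diff R W).
  by move=> A; rewrite /comparable_mono_diff properxx.
have big_deg (X : {set {set 'I_n}}) : m < #|X| ->
    exists2 v, v \in X & d.+1 <= #|[set A in X | comparable_mono_diff R W A v]|.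
  move=> lt_mX; apply/exists_inP; apply: contraLR lt_mX => /exists_inPn small.
  rewrite -leqNgt; apply: (sparse_family_le k_gt1 d_gt0 le_dn RW) => B XB.
  by have := small B XB; rewrite -ltnNge ltnS.
have card_PX : #|{: {set 'I_n}}| = 2 ^ n by rewrite card_all_sets card_ord.
have := card_pair_free_le setT irr (leq_exp_binomial (d := d.+1) le_ud) big_deg.
rewrite cardsT card_PX; congr (_ * _ <= _); apply: eq_card => F.
by rewrite !inE subsetT.
Qed.

Lemma num_families_le n (k d u c : nat) :
  1 < k -> 0 < d -> 4 * (k * (k * d)) <= n ->
  0 < u -> 2 * u.*2 ^ 3 <= d.+1 * d -> 2 ^ n <= u * c ->
  num_families n <= 2 ^ (n + ((k ^ 2 * 'C(n, n./2)) %/ k.-1 ^ 2 + (8 * k * 2 ^ n) %/ n + c)).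
Proof.
move=> k_gt1 d_gt0 le_dn u_gt0 le_ud le_nu; rewrite expnD.
have card_P : #|{: {set 'I_n}}| = 2 ^ n by rewrite card_all_sets card_ord.
have colC (R : {set 'I_n}) : two_colouring R (~: R).
  by rewrite /two_colouring setUCr eqxx -setI_eq0 setICr eqxx.
(* Union bound over the 2^n colourings, each determined by [R]. *)
apply: (@leq_trans (\sum_(R : {set 'I_n}) #|[set F | mono_diff_free R (~: R) F]|)); last first.
  rewrite -[X in _ <= X * _]card_P -sum_nat_const; apply: leq_sum => R _.
  exact: (card_mono_diff_free_le k_gt1 d_gt0 le_dn (colC R) u_gt0 le_ud le_nu).
have -> : \sum_(R : {set 'I_n}) #|[set F | mono_diff_free R (~: R) F]| =
    \sum_(F : {set {set 'I_n}}) \sum_(R : {set 'I_n}) mono_diff_free R (~: R) F.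
  rewrite exchange_big; apply: eq_bigr => R _.
  by rewrite -sum1dep_card big_mkcond; apply: eq_bigr => F _; case: mono_diff_free.
rewrite /num_families -sum1dep_card big_mkcond; apply: leq_sum => F _.
case: existsP => // -[R /existsP[W /andP[/andP[/eqP RW dis_RW] freeF]]].
rewrite (bigD1 R) //= (_ : ~: R = W) ?freeF //.
apply/setP => x; move/setP/(_ x): RW; rewrite !inE.
case Rx: (x \in R) => /=; last by move->.
by rewrite (disjointFr dis_RW Rx).
Qed.

Lemma num_families_ge n : 2 ^ 'C(n, n./2) <= num_families n.
Proof.
rewrite -[n in 'C(n, _)]card_ord -card_draws -card_powerset.
apply/subset_leq_card/subsetP => F; rewrite !inE => /subsetP layerF.
apply/existsP; exists setT; apply/existsP; exists set0.
rewrite /two_colouring setU0 eqxx -setI_eq0 setI0 eqxx /=.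
apply/forall_inP => A /layerF; rewrite inE => /eqP cardA.
apply/forall_inP => B /layerF; rewrite inE => /eqP cardB.
by rewrite negb_and; apply/orP; left; apply/negP => /proper_card; rewrite cardA cardB ltnn.
Qed.

(** * Choice of parameters *)

Lemma sqrt_floor n : exists s, s ^ 2 <= n < s.+1 ^ 2.
Proof.
elim: n => [|n [s /andP[le_sn lt_ns]]]; first by exists 0.
have [lt_nS|le_Sn] := ltnP n.+1 (s.+1 ^ 2); first by exists s; rewrite lt_nS (leqW le_sn).
exists s.+1; rewrite le_Sn /=; apply: leq_ltn_trans lt_ns _.
by rewrite ltn_sqr.
Qed.

(** The left side is of order k^3 s^3 and the right side at least of order s^4 / k^4, whence the
    seventh power. *)
Lemma degree_large_enough (k s d : nat) :
  0 < d -> 0 < s -> (8 * k) ^ 7 <= s -> s ^ 2 <= 4 * k ^ 2 * d.+1 ->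
  2 * (2 * k * s.+1).*2 ^ 3 <= d.+1 * d.
Proof.
move=> d_gt0 s_gt0; case: (posnP k) => [->|k_gt0]; first by rewrite muln0 mul0n muln0.
move def_K: (8 * k) => K le_Ks le_sd.
have K_gt0 : 0 < K by lia.
have le_x : 16 * s ^ 2 <= K ^ 2 * d.+1.
  apply: leq_trans (leq_mul (leqnn 16) le_sd) _.
  by apply: eq_leq; rewrite -def_K; ring.
have le_u3 : 2 * (2 * k * s.+1).*2 ^ 3 <= 2 * (K * s) ^ 3.
  have : (K * s.+1) ^ 3 <= (K * (2 * s)) ^ 3.
    by apply: leq_exp2rW; rewrite leq_mul2l; apply/orP; right; lia.
  rewrite (_ : (K * s.+1) ^ 3 = 4 * (2 * (2 * k * s.+1).*2 ^ 3)); last first.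
    by rewrite -def_K -muln2; ring.
  rewrite (_ : (K * (2 * s)) ^ 3 = 4 * (2 * (K * s) ^ 3)); last by ring.
  by rewrite leq_pmul2l.
apply: leq_trans le_u3 _; rewrite -(@leq_pmul2l (2 * K ^ 4)); last by rewrite muln_gt0 expn_gt0 K_gt0.
apply: (@leq_trans ((K ^ 2 * d.+1) ^ 2)); last first.
  rewrite (_ : (K ^ 2 * _) ^ 2 = K ^ 4 * (d.+1 * d.+1)); last by ring.
  rewrite (mulnC 2) -mulnA leq_mul2l; apply/orP; right.
  by rewrite mulnCA leq_mul2l; apply/orP; right; lia.
apply: leq_trans (leq_exp2rW 2 le_x).
rewrite (_ : 2 * K ^ 4 * _ = 4 * s ^ 3 * K ^ 7); last by ring.
apply: leq_trans (leq_mul (leqnn _) le_Ks) _.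
rewrite (_ : (16 * s ^ 2) ^ 2 = 256 * (s ^ 3 * s)); last by ring.
rewrite -mulnA leq_mul2r; apply/orP; by right.
Qed.

Lemma exp2_le_bin_mid (n s : nat) : n < s.+1 ^ 2 -> 2 ^ n <= 2 * 'C(n, n./2) * s.+1.
Proof.
have [->|n_gt0 lt_ns] := posnP n; first by rewrite bin0.
rewrite -leq_sqr -expnM (mulnC n) expnM; apply: leq_trans (bin_mid_sqr n_gt0) _.
set M := 'C(n, _); rewrite [leqRHS](_ : _ = 4 * s.+1 ^ 2 * M ^ 2); last by ring.
by rewrite leq_mul2r leq_mul2l ltnW ?orbT.
Qed.

Lemma mul_leq_bin_mid (n k : nat) : 16 * k <= n -> 0 < n -> k * n.+1 <= 'C(n, n./2).
Proof.
move=> le_kn n_gt0; apply: leq_trans (bin_le_mid n 2); have := bin_ffact n 2.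
rewrite !ffactnS ffactn0 muln1 (_ : 2`! = 2) // => eqC.
case: n n_gt0 le_kn eqC => // n _ /= le_kn eqC.
rewrite -(@leq_pmul2r 2) // eqC mulnAC mulnC.
apply: (@leq_trans (n.+1 * 2 * (k * 2))); first by lia.
rewrite -mulnA leq_mul2l /=; case: k le_kn => [|k]; lia.
Qed.

(** Amounts to k^3 <= (k + 8)(k - 1)^2 for k >= 2. *)
Lemma mul_quotient_le (k M : nat) : 1 < k ->
  k * ((k ^ 2 * M) %/ k.-1 ^ 2) <= (k + 8) * M.
Proof.
case: k => [|[|k]] // _; rewrite [k.+2.-1]/=.
have := leq_divM (k.+2 ^ 2 * M) (k.+1 ^ 2); move: (_ %/ _) => X le_X.
rewrite -(@leq_pmul2r (k.+1 ^ 2)) ?expn_gt0 // -mulnA.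
apply: leq_trans (leq_mul (leqnn _) le_X) _; rewrite mulnA [leqRHS]mulnAC leq_mul2r; apply/orP; right.
by rewrite !expnS expn0; nia.
Qed.

(** As 2^n is O(M s) and n >= s^2, the quotient is at most 32 k M / s. *)
Lemma unbalanced_term_le (n k s M : nat) : 0 < s -> s ^ 2 <= n -> (8 * k) ^ 2 <= s ->
  2 ^ n <= 2 * M * s.+1 -> k * ((8 * k * 2 ^ n) %/ n) <= M.
Proof.
move=> s_gt0 le_sn le_ks; move: (2 ^ n) => p le_p.
have := leq_divM (8 * k * p) n; move: (_ %/ _) => Y le_Y.
rewrite -(@leq_pmul2r (s ^ 2)) ?expn_gt0 ?s_gt0 //.
apply: (@leq_trans (k * (Y * n))); first by rewrite -mulnA !leq_mul.
apply: (@leq_trans (k * (8 * k * (2 * M * (2 * s))))).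
  rewrite leq_mul2l; apply/orP; right; apply: leq_trans le_Y _.
  rewrite leq_mul2l; apply/orP; right; apply: leq_trans le_p _.
  by rewrite leq_mul2l; apply/orP; right; lia.
apply: (@leq_trans (M * s * (8 * k) ^ 2)).
  rewrite (_ : k * _ = M * s * k ^ 2 * 32); last by ring.
  rewrite [leqRHS](_ : _ = M * s * k ^ 2 * 64); last by ring.
  by rewrite leq_mul2l orbT.
by rewrite [s ^ 2]expnS expn1 mulnA leq_mul2l le_ks orbT.
Qed.

Lemma num_families_exponent k : 1 < k -> exists n0, forall n, n0 <= n ->
  exists2 E, num_families n <= 2 ^ E & k * E <= (k + 11) * 'C(n, n./2).
Proof.
(* This makes the integer square root [s] of [n] exceed (8k)^7. *)
move=> k_gt1; exists (((8 * k) ^ 7).+1 ^ 2) => n.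
move def_K: (8 * k) => K le_n.
have [s /andP[le_sn lt_ns]] := sqrt_floor n.
have le_Ks : K ^ 7 <= s by have := leq_ltn_trans le_n lt_ns; rewrite ltn_sqr ltnS => /ltnW.
clear le_n.
have K_ge : 16 <= K by lia.
have KK_s : K ^ 2 <= s by apply: leq_trans le_Ks; apply: leq_pexp2l => //; lia.
have s_ge : K <= s by apply: leq_trans KK_s; rewrite -{1}[K]expn1; apply: leq_pexp2l => //; lia.
have s_gt0 : 0 < s := leq_trans (leq_trans (isT : 0 < 16) K_ge) s_ge.
set M := 'C(n, n./2).
(* [d] is the largest degree with 4 k^2 d <= n; [u] is chosen so that 2^n / u <= M / k, by
   [exp2_le_bin_mid]. *)
pose d := n %/ (4 * k ^ 2).
pose u := 2 * k * s.+1.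
pose c := (2 ^ n %/ u).+1.
have u_gt0 : 0 < u by rewrite /u !muln_gt0 /=; lia.
have d_gt0 : 0 < d.
  rewrite divn_gt0; last by rewrite muln_gt0 expn_gt0; lia.
  apply: leq_trans le_sn; move: KK_s; rewrite -def_K expnMn !expnS !expn0; nia.
have le_dn : 4 * (k * (k * d)) <= n.
  by apply: leq_trans (leq_divM n (4 * k ^ 2)); rewrite -/d; apply: eq_leq; ring.
have lt_nd : n < d.+1 * (4 * k ^ 2).
  by rewrite /d -ltn_divLR // muln_gt0 expn_gt0; lia.
have le_ud : 2 * u.*2 ^ 3 <= d.+1 * d.
  apply: degree_large_enough => //; first by rewrite def_K.
  by apply: leq_trans le_sn _; rewrite mulnC ltnW.
have le_nu : 2 ^ n <= u * c.
  by rewrite /c mulnC ltnW // -ltn_divLR.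
exists (n + ((k ^ 2 * M) %/ k.-1 ^ 2 + (8 * k * 2 ^ n) %/ n + c)).
  exact: (num_families_le k_gt1 d_gt0 le_dn u_gt0 le_ud le_nu).
have le_2n : 2 ^ n <= 2 * M * s.+1 by apply: exp2_le_bin_mid.
have le_kn : k * n.+1 <= M.
  have : 16 * K <= K ^ 2 by rewrite -mulnn leq_mul2r K_ge orbT.
  have : s <= s ^ 2 by rewrite -mulnn leq_pmull //; lia.
  by clear le_Ks => *; apply: mul_leq_bin_mid; lia.
have le1 : k * ((k ^ 2 * M) %/ k.-1 ^ 2) <= (k + 8) * M by apply: mul_quotient_le.
have le2 : k * ((8 * k * 2 ^ n) %/ n) <= M.
  by apply: (unbalanced_term_le s_gt0 le_sn _ le_2n); rewrite def_K.
have le3 : k * (2 ^ n %/ u) <= M.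
  rewrite -(@leq_pmul2r (2 * s.+1)) ?muln_gt0 //.
  rewrite (_ : _ * _ = 2 ^ n %/ u * u); last by rewrite /u; ring.
  by apply: leq_trans (leq_divM _ _) _; rewrite mulnA (mulnC M).
(* 11 = 8 + 1 + 1 + 1: the sparse bound gives 8, and the unbalanced sets, the branching and the
   colourings 1 each. The rounding in [c] is the extra 1 in k (n + 1) <= M. *)
move: le_kn le1 le2 le3; rewrite /c.
move: (_ %/ k.-1 ^ 2) (_ %/ n) (_ %/ u) => X Y Z; clear le_2n; move: M => M.
by clear => le_kn le1 le2 le3; rewrite !mulnDr !mulnS in le_kn *; lia.
Qed.

(* The asymptotic formula over the reals *)
From mathcomp Require Import all_classical all_reals all_analysis.
Import numFieldNormedType.Exports.
Local Open Scope classical_set_scope.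
Local Open Scope ring_scope.

Theorem theorem7p6 (K : realType) :
  exists o : nat -> K,
    (o @ \oo --> (0 : K)) /\
    (forall n : nat,
       (num_families n)%:R = (2 : K) `^ ('C(n, n./2)%:R * (1 + o n))).
Proof.
have ln2_gt0 : 0 < ln (2 : K) by apply: ln_gt0; rewrite ltr1n.
have M_gt0 n : 0 < 'C(n, n./2)%:R :> K by rewrite ltr0n bin_gt0; lia.
have num_ge n : (2 : K) ^+ 'C(n, n./2) <= (num_families n)%:R.
  by rewrite -natrX ler_nat num_families_ge.
have num_gt0 n : 0 < (num_families n)%:R :> K.
  by apply: lt_le_trans (num_ge n); apply: exprn_gt0.
(* The required identity solved for [o n]. *)
exists (fun n => ln (num_families n)%:R / ('C(n, n./2)%:R * ln 2) - 1); split; last first.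
  move=> n; rewrite addrC subrK /powR pnatr_eq0 /=.
  rewrite mulrCA invfM mulVKf ?gt_eqF // mulfVK ?gt_eqF //.
  by rewrite lnK ?posrE.
apply/cvgrPdist_le => e e_gt0.
(* The exponent bound gives o(n) <= 11/k, so [k] is taken with 11/k <= e. *)
have [k k_gt1 le_ke] : exists2 k, (1 < k)%N & 11 <= e * k%:R.
  exists (Num.trunc (11 / e)).+2 => //.
  by rewrite mulrC -ler_pdivrMr // ltW // (lt_trans (truncnS_gt _)) // ltr_nat.
have [n0 bound] := num_families_exponent k_gt1.
exists n0 => // n /= /bound[E le_num le_E].
have k_gt0 : 0 < k%:R :> K by rewrite ltr0n ltnW.
(* The middle-layer lower bound makes [o n] nonnegative, so only the upper bound needs [k]. *)
rewrite sub0r normrN ger0_norm.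
  rewrite lerBlDr ler_pdivrMr ?mulr_gt0 //.
  apply: (@le_trans _ _ (E%:R * ln 2)).
    rewrite mulr_natl -lnXn // ler_ln ?posrE ?exprn_gt0 //.
    by rewrite -natrX ler_nat.
  rewrite mulrA ler_pM2r // -(ler_pM2l k_gt0).
  move: le_E; rewrite -(ler_nat K) !natrM natrD => le_E; apply: le_trans le_E _.
  by rewrite mulrA ler_pM2r // mulrDr mulr1 addrC lerD2r mulrC.
by rewrite subr_ge0 ler_pdivlMr ?mulr_gt0 // mul1r mulr_natl -lnXn // ler_ln ?posrE ?exprn_gt0.
Qed.
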